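(* Let $U\in\operatorname{St}(n,p)$ and $\xi,\eta\in T_U\operatorname{St}(n,p)$. If $\|\xi-\eta\|_F<1$, then $$\operatorname{dist}_E(\mathcal{R}_U(\xi),\mathcal{R}_U(\eta))\le 2\arcsin(\|\xi-\eta\|_F),$$ where $\operatorname{dist}_E$ is the Riemannian distance under the Euclidean metric.
   Context: Let $p\le n$ be positive integers. $\operatorname{St}(n,p)=\{U\in\mathbb{R}^{n\times p}: U^TU=I_p\}$ is the Stiefel manifold, with tangent spaces $T_U\operatorname{St}(n,p)=\{\xi\in\mathbb{R}^{n\times p}:U^T\xi+\xi^TU=0\}$; the Euclidean metric is $g_e(\xi,\Delta)=\operatorname{tr}(\xi^T\Delta)$. $\|\cdot\|_F$ is the Frobenius norm. The Cayley transformation of a skew-symmetric matrix $A$ is $\operatorname{Cay}(A)=(I-A)^{-1}(I+A)$. The canonical Cayley retraction at $U$ is $$\mathcal{R}_U(\xi)=\operatorname{Cay}\left(\tfrac12\left(P_U\xi U^T-U\xi^TP_U\right)\right)U,\qquad P_U=I_n-\tfrac12UU^T.$$ *)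

(* Defs.v *)
From HB Require Import structures.
From mathcomp Require Import all_boot all_order all_algebra.
From mathcomp Require Import all_classical all_reals all_analysis.
Set Implicit Arguments.
Unset Strict Implicit.
Unset Printing Implicit Defensive.
Import Order.TTheory GRing.Theory Num.Theory.
Import numFieldNormedType.Exports.
Local Open Scope classical_set_scope.
Local Open Scope ring_scope.

Section Stiefel.
Variables (R : realType) (n p : nat).
Implicit Types (U V xi Delta : 'M[R]_(n, p)) (gamma : R -> 'M[R]_(n, p)).

Definition stiefel : set 'M[R]_(n, p) := [set U | U^T *m U = 1%:M].

Definition tangent U : set 'M[R]_(n, p) :=
  [set xi | U^T *m xi + xi^T *m U = 0].

Definition euclidean_metric xi Delta : R := \tr (xi^T *m Delta).

(* The library norm `|A| on matrices is the max norm, hence this definition. *)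
Definition frobenius_norm xi : R :=
  Num.sqrt (\sum_(i < n) \sum_(j < p) xi i j ^+ 2).

Definition smooth gamma : Prop :=
  forall (k : nat) (t : R), derivable (derive1n k gamma) t 1.

(* The restriction of gamma to each closed piece of a subdivision
   a = t_0 < t_1 < ... < t_k = b extends to a smooth map on the real line.
   As consecutive closed pieces share an endpoint, gamma is continuous on
   [a, b]; its values outside [a, b] are irrelevant. *)
Definition piecewise_smooth (a b : R) gamma : Prop :=
  exists2 s : seq R, itv_partition a b s &
    forall i : nat, (i < size s)%N ->
      exists2 g : R -> 'M[R]_(n, p), smooth g &
        {in `[nth b (a :: s) i, nth b s i], gamma =1 g}.

(* At the finitely many breakpoints and endpoints derive1 gamma may be a junk
   value; this does not affect the integral. *)
Definition curve_length (a b : R) gamma : \bar R :=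
  \int[lebesgue_measure]_(t in `[a, b])
    (Num.sqrt (euclidean_metric (derive1 gamma t) (derive1 gamma t)))%:E.

Definition stiefel_curve U V gamma : Prop :=
  [/\ piecewise_smooth 0 1 gamma,
      (forall t, t \in `[0, 1] -> stiefel (gamma t)),
      gamma 0 = U & gamma 1 = V].

(* The value is +oo when no curve in the manifold joins U to V, which can
   happen for p = n. *)
Definition distE U V : \bar R :=
  ereal_inf [set curve_length 0 1 gamma | gamma in stiefel_curve U V].

Definition Cay (A : 'M[R]_n) : 'M[R]_n :=
  invmx (1%:M - A) *m (1%:M + A).

Definition P_ U : 'M[R]_n := 1%:M - 2^-1 *: (U *m U^T).

Definition cayley_retraction U xi : 'M[R]_(n, p) :=
  Cay (2^-1 *: (P_ U *m xi *m U^T - U *m xi^T *m P_ U)) *m U.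

End Stiefel.

(* Main.v *)
(* Let A(xi) = (P xi U^T - U xi^T P) / 2, which is linear in xi, and join the two
   points by gamma(t) = Cay(A(xi + t (eta - xi))) U, a curve in the Stiefel
   manifold because Cay maps skew-symmetric matrices to orthogonal ones. With
   B = A(eta - xi) and G = (I - A(xi) - t B)^-1 one has Cay = 2 G - I, hence
   gamma' = 2 G B G U. For S skew-symmetric, |(I - S) M|^2 = |M|^2 + |S M|^2, so
   multiplication by G on either side does not increase the Frobenius norm;
   neither does multiplication by U, and |B| <= |xi - eta| by the parallelogram
   inequality. The length of gamma is thus at most
   2 |xi - eta| <= 2 arcsin |xi - eta|. *)
Require Import Defs.
From mathcomp Require Import all_boot all_order all_algebra.
From mathcomp Require Import all_classical all_reals all_analysis.
From mathcomp Require Import ring lra.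
Import Order.TTheory GRing.Theory Num.Theory.
Import measurable_realfun.
Import numFieldNormedType.Exports.
Local Open Scope classical_set_scope.
Local Open Scope ring_scope.

Set Implicit Arguments.
Unset Strict Implicit.
Unset Printing Implicit Defensive.

(** * The squared Frobenius norm and multiplications that do not increase it *)

Lemma euclidean_metric_ge0 (R : realType) (m k : nat) (A : 'M[R]_(m, k)) :
  0 <= euclidean_metric A A.
Proof.
rewrite /euclidean_metric /mxtrace; apply: sumr_ge0 => i _.
by rewrite mxE; apply: sumr_ge0 => j _; rewrite mxE -expr2 sqr_ge0.
Qed.

Lemma euclidean_metric_eq0 (R : realType) (m k : nat) (A : 'M[R]_(m, k)) :
  euclidean_metric A A = 0 -> A = 0.
Proof.
have sq_ge0 (i : 'I_k) : 0 <= (A^T *m A) i i.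
  by rewrite mxE; apply: sumr_ge0 => j _; rewrite mxE -expr2 sqr_ge0.
rewrite /euclidean_metric /mxtrace => /eqP; rewrite psumr_eq0 // => /allP A0.
apply/matrixP => j i; rewrite mxE; apply/eqP.
have /eqP := A0 i (mem_index_enum i); rewrite mxE => /eqP.
rewrite psumr_eq0 => [|l _]; last by rewrite mxE -expr2 sqr_ge0.
by move/allP => /(_ j (mem_index_enum j)); rewrite mxE -expr2 sqrf_eq0.
Qed.

Lemma frobenius_norm_sqr (R : realType) (m k : nat) (A : 'M[R]_(m, k)) :
  frobenius_norm A ^+ 2 = euclidean_metric A A.
Proof.
rewrite /frobenius_norm sqr_sqrtr; last first.
  by apply: sumr_ge0 => i _; apply: sumr_ge0 => j _; rewrite sqr_ge0.
rewrite /euclidean_metric /mxtrace exchange_big; apply: eq_bigr => j _.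
by rewrite mxE; apply: eq_bigr => i _; rewrite mxE expr2.
Qed.

Lemma euclidean_metric_trmx (R : realType) (m k : nat) (A : 'M[R]_(m, k)) :
  euclidean_metric A^T A^T = euclidean_metric A A.
Proof. by rewrite /euclidean_metric trmxK mxtrace_mulC. Qed.

Lemma euclidean_metricZ (R : realType) (m k : nat) (c : R)
    (A : 'M[R]_(m, k)) :
  euclidean_metric (c *: A) (c *: A) = c ^+ 2 * euclidean_metric A A.
Proof.
by rewrite /euclidean_metric [(c *: A)^T]linearZ /= -scalemxAl -scalemxAr !mxtraceZ mulrA.
Qed.

Lemma euclidean_metricB_le (R : realType) (m k : nat) (A B : 'M[R]_(m, k)) :
  euclidean_metric (A - B) (A - B) <=
    2 * (euclidean_metric A A + euclidean_metric B B).
Proof.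
have parallelogram : euclidean_metric (A - B) (A - B) +
    euclidean_metric (A + B) (A + B) =
    2 * (euclidean_metric A A + euclidean_metric B B).
  rewrite /euclidean_metric [(A - B)^T]linearB [(A + B)^T]linearD /=.
  rewrite !(mulmxDl, mulmxBl, mulmxBr, mulmxDr).
  rewrite !(mxtraceD, raddfN, mulmxN, mulNmx) /=; ring.
by rewrite -parallelogram lerDl euclidean_metric_ge0.
Qed.

(* For S skew-symmetric, (I - S)^T (I - S) = I + S^T S. *)
Lemma euclidean_metric_skew (R : realType) (n k : nat) (S : 'M[R]_n)
    (M : 'M[R]_(n, k)) : S^T = - S ->
  euclidean_metric ((1%:M - S) *m M) ((1%:M - S) *m M) =
    euclidean_metric M M + euclidean_metric (S *m M) (S *m M).
Proof.
move=> St; rewrite /euclidean_metric -mxtraceD; congr (\tr _).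
rewrite !trmx_mul linearB /= trmx1 St opprK mulmxBl mul1mx.
rewrite !(mulmxDr, mulmxDl, mulmxN, mulNmx, mulmx1, mulmxA).
by rewrite addrA addrK.
Qed.

(** If K (I - S) = 0, transposing gives (I + S) K^T = 0, and [euclidean_metric_skew] for -S turns
    this into |K^T|^2 + |S K^T|^2 = 0, so K = 0. *)
Lemma skew_unitmx (R : realType) (n : nat) (S : 'M[R]_n) :
  S^T = - S -> 1%:M - S \in unitmx.
Proof.
move=> St; rewrite -row_free_unit -kermx_eq0; apply/eqP/trmx_inj.
rewrite trmx0; apply: euclidean_metric_eq0; apply/eqP.
have := mulmx_ker (1%:M - S); move/(congr1 trmx).
rewrite trmx_mul linearB /= trmx1 trmx0 St => K0.
have St' : (- S)^T = - (- S) by rewrite linearN /= St.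
have := euclidean_metric_skew (kermx (1%:M - S))^T St'.
rewrite K0 /euclidean_metric mulmx0 mxtrace0 => /esym/eqP.
rewrite paddr_eq0; first by case/andP.
- exact: euclidean_metric_ge0.
- exact: euclidean_metric_ge0.
Qed.

Lemma resolvent_contraction (R : realType) (n k : nat) (S : 'M[R]_n)
    (M : 'M[R]_(n, k)) : S^T = - S ->
  euclidean_metric (invmx (1%:M - S) *m M) (invmx (1%:M - S) *m M) <=
    euclidean_metric M M.
Proof.
move=> St; rewrite -[in leRHS](mulKVmx (skew_unitmx St) M).
by rewrite euclidean_metric_skew // lerDl euclidean_metric_ge0.
Qed.

Lemma trmx_resolvent (R : realType) (n : nat) (S : 'M[R]_n) : S^T = - S ->
  (invmx (1%:M - S))^T = invmx (1%:M + S).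
Proof. by move=> St; rewrite trmx_inv linearB /= trmx1 St opprK. Qed.

(** Transposition turns right multiplication by (I - S)^-1 into left multiplication by (I + S)^-1,
    and -S is skew-symmetric as well. *)
Lemma resolvent_contraction_r (R : realType) (n k : nat) (S : 'M[R]_n)
    (M : 'M[R]_(k, n)) : S^T = - S ->
  euclidean_metric (M *m invmx (1%:M - S)) (M *m invmx (1%:M - S)) <=
    euclidean_metric M M.
Proof.
move=> St; rewrite -euclidean_metric_trmx -[leRHS]euclidean_metric_trmx.
rewrite trmx_mul trmx_resolvent // -[S]opprK.
by apply: resolvent_contraction; rewrite linearN /= St.
Qed.

(** Pythagoras for the orthogonal projection U U^T: |M|^2 = |M U|^2 + |M (I - U U^T)|^2. *)
Lemma stiefel_contraction (R : realType) (n p k : nat) (U : 'M[R]_(n, p))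
    (M : 'M[R]_(k, n)) : stiefel U ->
  euclidean_metric (M *m U) (M *m U) <= euclidean_metric M M.
Proof.
rewrite /stiefel /= => UU.
rewrite -[leLHS]euclidean_metric_trmx -[leRHS]euclidean_metric_trmx.
have -> : euclidean_metric M^T M^T = euclidean_metric (M *m U)^T (M *m U)^T +
    euclidean_metric (M *m (1%:M - U *m U^T))^T (M *m (1%:M - U *m U^T))^T.
  rewrite /euclidean_metric -mxtraceD !trmxK; congr (\tr _).
  have Et : (1%:M - U *m U^T)^T = 1%:M - U *m U^T.
    by rewrite [LHS]linearB /= trmx1 trmx_mul trmxK.
  have EE : (1%:M - U *m U^T) *m (1%:M - U *m U^T) = 1%:M - U *m U^T.
    by rewrite mulmxBr mulmx1 mulmxBl mul1mx mulmxA -(mulmxA U) UU mulmx1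
      subrr subr0.
  rewrite !trmx_mul Et !mulmxA -(mulmxA M) -(mulmxA M _ (1%:M - _)) EE.
  by rewrite -mulmxDl -mulmxDr addrC subrK mulmx1.
by rewrite lerDl euclidean_metric_ge0.
Qed.

Lemma stiefel_isometry (R : realType) (n p k : nat) (U : 'M[R]_(n, p))
    (M : 'M[R]_(k, p)) : stiefel U ->
  euclidean_metric (M *m U^T) (M *m U^T) = euclidean_metric M M.
Proof.
rewrite /stiefel /= => UU.
rewrite -euclidean_metric_trmx -[RHS]euclidean_metric_trmx.
rewrite /euclidean_metric !trmxK trmx_mul trmxK.
by rewrite mulmxA -(mulmxA M) UU mulmx1.
Qed.

Lemma trmx_P (R : realType) (n p : nat) (U : 'M[R]_(n, p)) : (P_ U)^T = P_ U.
Proof.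
by rewrite /P_ [LHS]linearB /= trmx1 [X in _ - X]linearZ /= trmx_mul trmxK.
Qed.

(** As U U^T is idempotent and -1 + 1/4 = -3/4, the square of P is I - (3/4) U U^T; hence |D|^2 = |P
    D|^2 + (3/4) |U^T D|^2. *)
Lemma P_contraction (R : realType) (n p k : nat) (U : 'M[R]_(n, p))
    (D : 'M[R]_(n, k)) : stiefel U ->
  euclidean_metric (P_ U *m D) (P_ U *m D) <= euclidean_metric D D.
Proof.
rewrite /stiefel /= => UU.
have -> : euclidean_metric D D = euclidean_metric (P_ U *m D) (P_ U *m D) +
    3 / 4 * euclidean_metric (U^T *m D) (U^T *m D).
  rewrite /euclidean_metric -mxtraceZ -mxtraceD; congr (\tr _).
  have PP : P_ U *m P_ U = 1%:M - (3 / 4) *: (U *m U^T).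
    rewrite /P_ mulmxBr mulmx1 mulmxBl mul1mx -scalemxAl -scalemxAr mulmxA.
    rewrite -(mulmxA U) UU mulmx1 scalerA -addrA -!opprD; congr (_ - _).
    by rewrite addrC addrAC -scalerDl -scalerBl; congr (_ *: _); field.
  rewrite !trmx_mul trmx_P trmxK !mulmxA -(mulmxA D^T) PP -(mulmxA D^T U).
  by rewrite mulmxBr mulmx1 mulmxBl -scalemxAr -scalemxAl subrK.
by rewrite lerDl mulr_ge0 ?divr_ge0 ?euclidean_metric_ge0.
Qed.

(** * The Cayley transform of a skew-symmetric matrix *)

Lemma CayE (R : realType) (n : nat) (S : 'M[R]_n) : S^T = - S ->
  Cay S = 2 *: invmx (1%:M - S) - 1%:M.
Proof.
move=> St; rewrite /Cay.
(* This leaves the resolvent as the only nonconstant term to differentiate along the curve. *)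
have -> : 1%:M + S = 2 *: 1%:M - (1%:M - S).
  by rewrite opprB addrCA addrC scaler_nat mulr2n addrK.
by rewrite mulmxBr mulVmx ?skew_unitmx // -scalemxAr mulmx1.
Qed.

(** With G = (I - S)^-1 and H = G^T = (I + S)^-1 the product is (2 H - I)(2 G - I). Since (I - S) +
    (I + S) = 2 I, one has 2 H G = H + G, and everything but I cancels. *)
Lemma Cay_orthogonal (R : realType) (n : nat) (S : 'M[R]_n) : S^T = - S ->
  (Cay S)^T *m Cay S = 1%:M.
Proof.
move=> St; rewrite CayE // [X in X *m _]linearB /= [X in X - _]linearZ /= trmx1.
have Gt := trmx_resolvent St; have uS := skew_unitmx St.
have uS' : 1%:M + S \in unitmx.
  by rewrite -[S]opprK; apply: skew_unitmx; rewrite linearN /= St.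
set G := invmx (1%:M - S) in Gt *; rewrite Gt.
set H := invmx (1%:M + S).
have HGD : 2 *: (H *m G) = H + G.
  have -> : H + G = H *m ((1%:M - S) + (1%:M + S)) *m G.
    by rewrite mulmxDr mulmxDl -mulmxA mulmxV // mulmx1 mulVmx // mul1mx.
  rewrite addrACA addNr addr0 -mulr2n -[_%:M *+ 2]scaler_nat.
  by rewrite -scalemxAr mulmx1 -scalemxAl.
rewrite mulmxBr mulmx1 mulmxBl mul1mx -scalemxAl -scalemxAr HGD scalerDr.
by rewrite addrK opprB addrC subrK.
Qed.

(** * Differentiation of matrix-valued functions *)

Lemma is_derive_mxP (R : realType) (m k : nat) (M : R -> 'M[R]_(m, k)) (t : R)
    (dM : 'M[R]_(m, k)) :
  is_derive t 1 M dM <-> forall i j, is_derive t 1 (fun x => M x i j) (dM i j).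
Proof.
split=> [MdM i j|MdM].
  have Md : derivable M t 1 by apply: ex_derive.
  apply: DeriveDef; first exact: (derivable_mxP M t 1).1.
  have := derive_mx Md; rewrite (derive_val (is_derive := MdM)) => ->.
  by rewrite mxE.
have Md : derivable M t 1.
  by apply/derivable_mxP => i j; apply: ex_derive.
apply: DeriveDef => //; rewrite derive_mx //; apply/matrixP => i j.
by rewrite mxE; apply: derive_val.
Qed.

Lemma is_derive_mulmx (R : realType) (m k l : nat) (M : R -> 'M[R]_(m, k))
    (N : R -> 'M[R]_(k, l)) (t : R) (dM : 'M[R]_(m, k)) (dN : 'M[R]_(k, l)) :
  is_derive t 1 M dM -> is_derive t 1 N dN ->
  is_derive t 1 (fun x => M x *m N x) (dM *m N t + M t *m dN).
Proof.
move=> /is_derive_mxP MdM /is_derive_mxP NdN; apply/is_derive_mxP => i j.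
have -> : (fun x => (M x *m N x) i j) =
    \sum_(q < k) ((fun x => M x i q) * (fun x => N x q j)).
  by apply/funext => x; rewrite mxE fct_sumE.
have -> : (dM *m N t + M t *m dN) i j =
    \sum_(q < k) (M t i q *: dN q j + N t q j *: dM i q).
  rewrite !mxE -big_split; apply: eq_bigr => q _ /=.
  by rewrite addrC [dM _ _ * _]mulrC.
by apply: is_derive_sum => q; apply: is_deriveM.
Qed.

Lemma derivable_det (R : realType) (n : nat) (M : R -> 'M[R]_n) (t : R) :
  derivable M t 1 -> derivable (fun x => \det (M x)) t 1.
Proof.
move=> /derivable_mxP Md; rewrite /determinant.
(* The Leibniz sum over permutations is generalised to an arbitrary list, then the product over
   indices likewise, so that both yield to induction. *)
elim: (index_enum _) => [|s r IHr].
  under eq_fun do rewrite big_nil.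
  exact: derivable_cst.
under eq_fun do rewrite big_cons.
apply: derivableD; last exact: IHr.
apply: derivableM; first exact: derivable_cst.
elim: (index_enum _) => [|i r' IHr'].
  under eq_fun do rewrite big_nil.
  exact: derivable_cst.
under eq_fun do rewrite big_cons.
exact: derivableM (Md _ _) IHr'.
Qed.

(** Cramer's rule: each entry of the inverse is a cofactor divided by the nonzero determinant. *)
Lemma derivable_invmx (R : realType) (n : nat) (M : R -> 'M[R]_n) (t : R) :
  (forall x, M x \in unitmx) -> derivable M t 1 ->
  derivable (fun x => invmx (M x)) t 1.
Proof.
move=> uM Md; apply/derivable_mxP => i j.
have -> : (fun x => invmx (M x) i j) =
    (fun x => (\det (M x))^-1) * (fun x => cofactor (M x) j i).
  by apply/funext => x; rewrite /invmx uM !mxE.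
apply: derivableM.
  apply: derivableV; last exact: derivable_det.
  by have := uM t; rewrite unitmxE unitfE.
rewrite /cofactor; apply: derivableM; first exact: derivable_cst.
apply: derivable_det; apply/derivable_mxP => a b.
under eq_fun do rewrite !mxE.
exact: ((derivable_mxP M t 1).1 Md).
Qed.

(** Once G = M^-1 is known to be differentiable, differentiating G M = I gives G' M + G M' = 0,
    which is solved for G'. *)
Lemma is_derive_invmx (R : realType) (n : nat) (M : R -> 'M[R]_n) (t : R)
    (dM : 'M[R]_n) :
  (forall x, M x \in unitmx) -> is_derive t 1 M dM ->
  is_derive t 1 (fun x => invmx (M x)) (- (invmx (M t) *m dM *m invmx (M t))).
Proof.
move=> uM MdM.
have Gd : derivable (fun x => invmx (M x)) t 1.
  by apply: derivable_invmx => //; apply: ex_derive.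
apply: DeriveDef => //; set dG := 'D_1 _ t.
have GdG : is_derive t 1 (fun x => invmx (M x)) dG by apply: DeriveDef.
have := is_derive_mulmx GdG MdM.
have -> : (fun x => invmx (M x) *m M x) = cst 1%:M.
  by apply/funext => x; rewrite mulVmx.
move=> /(@derive_val _ _ _ _ _ _ _); rewrite derive_cst => /esym/eqP.
rewrite addr_eq0 => /eqP /(congr1 (mulmxr (invmx (M t)))) /=.
by rewrite mulmxK // mulNmx.
Qed.

(** * Derivatives of the resolvent along a line of skew-symmetric matrices *)

Lemma skew_line (R : realType) (n : nat) (A B : 'M[R]_n) (t : R) :
  A^T = - A -> B^T = - B -> (A + t *: B)^T = - (A + t *: B).
Proof.
move=> At Bt; rewrite [LHS]linearD /= [X in _ + X]linearZ /= At Bt.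
by rewrite scalerN opprD.
Qed.

Lemma is_derive_resolvent (R : realType) (n : nat) (A B : 'M[R]_n) (t : R) :
  A^T = - A -> B^T = - B ->
  is_derive t 1 (fun x => invmx (1%:M - (A + x *: B)))
    (invmx (1%:M - (A + t *: B)) *m B *m invmx (1%:M - (A + t *: B))).
Proof.
move=> At Bt.
have line : is_derive t 1 (fun x : R => 1%:M - (A + x *: B)) (- B).
  apply/is_derive_mxP => i j.
  have -> : (fun x : R => (1%:M - (A + x *: B)) i j) =
      cst (1%:M i j - A i j) - (fun x => B i j *: x).
    by apply/funext => x; rewrite !mxE opprD addrA /= [x * _]mulrC.
  apply: is_derive_eq.
  by rewrite sub0r !mxE scaler1.
apply: is_derive_eq.
  apply: is_derive_invmx line => x.
  exact/skew_unitmx/skew_line.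
by rewrite mulmxN mulNmx opprK.
Qed.

(* G (B G)^k, where G = (I - A - t B)^-1; its derivative in t is k + 1 times
   the next such word, so all derivatives of the Cayley curve are explicit. *)
Definition resolvent_word (R : realType) (n : nat) (A B : 'M[R]_n) (k : nat)
    (t : R) : 'M[R]_n :=
  iter k (fun X => X *m B *m invmx (1%:M - (A + t *: B)))
    (invmx (1%:M - (A + t *: B))).

Lemma mul_resolvent_word (R : realType) (n : nat) (A B : 'M[R]_n) (k : nat)
    (t : R) :
  resolvent_word A B k t *m B *m invmx (1%:M - (A + t *: B)) =
    resolvent_word A B k.+1 t.
Proof. by []. Qed.

(** Induction by the product rule on the last factor G: the shorter word before it contributes its
    own multiple of the next word, and G' = G B G contributes one more copy. *)
Lemma is_derive_resolvent_word (R : realType) (n : nat) (A B : 'M[R]_n)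
    (k : nat) (t : R) : A^T = - A -> B^T = - B ->
  is_derive t 1 (resolvent_word A B k)
    (k.+1%:R *: resolvent_word A B k.+1 t).
Proof.
move=> At Bt; elim: k => [|k IHk].
  by rewrite scale1r; exact: is_derive_resolvent.
apply: is_derive_eq.
  apply: is_derive_mulmx (is_derive_resolvent t At Bt).
  exact: is_derive_mulmx IHk (is_derive_cst _ _ _).
rewrite mulmx0 addr0 -!scalemxAl !mulmxA !mul_resolvent_word.
by rewrite -[X in _ + X]scale1r -scalerDl natr1.
Qed.

(** * The Cayley curve: smoothness, speed and length *)

Section CayleyCurve.
Variables (R : realType) (n p : nat) (A B : 'M[R]_n) (U : 'M[R]_(n, p)).
Hypotheses (At : A^T = - A) (Bt : B^T = - B).

Let gamma t := Cay (A + t *: B) *m U.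

(** This shape is stable under differentiation. It covers the curve itself, with [D] = -U, and its
    derivatives, with [D] = 0. *)
Lemma is_derive_word_mul (c t : R) (k : nat) (D : 'M[R]_(n, p)) :
  is_derive t 1 (fun x => c *: resolvent_word A B k x *m U + D)
    ((c * k.+1%:R) *: resolvent_word A B k.+1 t *m U).
Proof.
have cw : is_derive t 1 (fun x => c *: resolvent_word A B k x *m U)
    ((c * k.+1%:R) *: resolvent_word A B k.+1 t *m U).
  have -> : (fun x => c *: resolvent_word A B k x *m U) =
      (fun x => resolvent_word A B k x *m (c *: U)).
    by apply/funext => x; rewrite -scalemxAl scalemxAr.
  apply: is_derive_eq.
    exact: is_derive_mulmx (is_derive_resolvent_word k t At Bt)
      (is_derive_cst _ _ _).
  by rewrite mulmx0 addr0 -scalemxAr -!scalemxAl scalerA.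
have := is_deriveD cw (is_derive_cst D t 1).
by rewrite addr0.
Qed.

Lemma cayley_curveE : gamma = fun t => 2 *: resolvent_word A B 0 t *m U + - U.
Proof.
by apply/funext => t; rewrite /gamma CayE ?mulmxBl ?mul1mx //; exact: skew_line.
Qed.

Lemma derive1n_cayley_curve (k : nat) : exists c D,
  derive1n k gamma = fun t => c *: resolvent_word A B k t *m U + D.
Proof.
elim: k => [|k [c [D IHk]]]; first by exists 2, (- U); exact: cayley_curveE.
exists (c * k.+1%:R), 0; apply/funext => t.
rewrite /derive1n iterS -/(derive1n k gamma) IHk derive1E addr0.
exact: (derive_val (is_derive := is_derive_word_mul c t k D)).
Qed.

Lemma smooth_cayley_curve : smooth gamma.
Proof.
move=> k t; have [c [D ->]] := derive1n_cayley_curve k.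
exact: (ex_derive (is_derive := is_derive_word_mul c t k D)).
Qed.

Lemma derive1_cayley_curve (t : R) :
  derive1 gamma t = 2 *: resolvent_word A B 1 t *m U.
Proof.
rewrite derive1E cayley_curveE.
by rewrite (derive_val (is_derive := is_derive_word_mul 2 t 0 (- U))) mulr1.
Qed.

Lemma cayley_curve_speed (t : R) : stiefel U ->
  euclidean_metric (derive1 gamma t) (derive1 gamma t) <=
    4 * euclidean_metric B B.
Proof.
move=> hU; have St := skew_line t At Bt.
rewrite derive1_cayley_curve -scalemxAl euclidean_metricZ -natrX.
(* The velocity is 2 G B G U; the factors U, right G and left G are removed in this order. *)
rewrite ler_pM2l // (le_trans (stiefel_contraction _ hU)) //.
rewrite /resolvent_word /= (le_trans (resolvent_contraction_r _ St)) //.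
exact: resolvent_contraction.
Qed.

Lemma cayley_curve_stiefel (t : R) : stiefel U -> stiefel (gamma t).
Proof.
rewrite /stiefel /= => UU; rewrite /gamma trmx_mul mulmxA -(mulmxA U^T).
by rewrite Cay_orthogonal ?mulmx1 //; exact: skew_line.
Qed.

(** Serves to compare the integral of the speed with that of a constant. The squared speed is a sum
    of squares of differentiable entries, so the speed is continuous. *)
Lemma cayley_curve_speed_measurable :
  measurable_fun (`[0, 1] : set R) (fun t : R =>
    Num.sqrt (euclidean_metric (derive1 gamma t) (derive1 gamma t)) : R).
Proof.
have speed_sqr : (fun t : R =>
      euclidean_metric (derive1 gamma t) (derive1 gamma t)) =
    \sum_(j < p) \sum_(i < n) (fun t => derive1 gamma t i j) ^+ 2.
  apply/funext => x; rewrite fct_sumE /euclidean_metric /mxtrace.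
  apply: eq_bigr => j _; rewrite mxE fct_sumE; apply: eq_bigr => i _.
  by rewrite mxE.
have cont : continuous (fun t : R =>
    euclidean_metric (derive1 gamma t) (derive1 gamma t)).
  move=> t; apply/differentiable_continuous/derivable1_diffP; rewrite speed_sqr.
  apply: derivable_sum => j; apply: derivable_sum => i; apply: derivableX.
  have gd : derivable (derive1 gamma) t 1 := @smooth_cayley_curve 1 t.
  exact: ((derivable_mxP (derive1 gamma) t 1).1 gd i j).
apply: (measurable_funS measurableT) => //.
apply: continuous_measurable_fun => t.
exact: (continuous_comp (cont t) (@sqrt_continuous R _)).
Qed.

Lemma cayley_curve_length : stiefel U ->
  (curve_length 0 1 gamma <= (2 * Num.sqrt (euclidean_metric B B))%:E)%E.
Proof.
move=> hU; rewrite /curve_length.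
apply: (@le_trans _ _ (\int[lebesgue_measure]_(t in `[0%R, 1%R])
    (2 * Num.sqrt (euclidean_metric B B))%:E)%E).
  apply: ge0_le_integral => //.
  - apply/measurable_EFinP.
    exact: cayley_curve_speed_measurable.
  - move=> t _; rewrite lee_fin.
    have -> : 2 * Num.sqrt (euclidean_metric B B) =
        Num.sqrt (4 * euclidean_metric B B).
      by rewrite sqrtrM // -[4]/((2 * 2)%:R) natrM -expr2 sqrtr_sqr ger0_norm.
    by rewrite ler_wsqrtr //; exact: cayley_curve_speed.
by rewrite integral_cst //= lebesgue_measure_itv /= lte_fin ltr01 EFinN sube0 mule1.
Qed.

End CayleyCurve.

(** * Comparison with the arcsine *)

Lemma asin_ge_id (R : realType) (x : R) : 0 <= x < 1 -> x <= asin x.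
Proof.
case/andP => x0 x1.
have der (y : R) : y \in `]0, x[ -> is_derive y 1 asin (Num.sqrt (1 - y ^+ 2))^-1.
  rewrite in_itv /= => /andP[y0 yx]; apply: is_derive1_asin.
  by rewrite (lt_trans yx) // andbT (lt_trans _ y0) // oppr_lt0.
have asin0 : asin 0 = 0 :> R.
  rewrite -[X in asin X]sin0 sinK // in_itv /= oppr_le0.
  by rewrite divr_ge0 ?pi_ge0.
have cont : {within `[0, x], continuous asin}.
  apply: continuous_in_subspaceT => y; rewrite inE /= in_itv /= => /andP[y0 yx].
  apply: continuous_asin; rewrite (le_lt_trans yx) // andbT.
  by rewrite (lt_le_trans _ y0) // oppr_lt0.
(* Mean value theorem on [0, x]; as x < 1, the point c stays away from the singularity of the
   derivative at 1, and the slope at c is at least 1. *)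
have [c cx ->] : exists2 c, c \in `[0, x] &
    asin x = (Num.sqrt (1 - c ^+ 2))^-1 * x.
  have [c cx] := MVT_segment x0 der cont.
  by rewrite asin0 !subr0 => ->; exists c.
move: cx; rewrite in_itv /= => /andP[c0 cx].
have c1 : c ^+ 2 < 1 by rewrite expr_lt1 // (le_lt_trans cx).
rewrite ler_peMl // invf_ge1; last by rewrite sqrtr_gt0 subr_gt0.
by rewrite -[leRHS]sqrtr1 ler_wsqrtr // gerBl sqr_ge0.
Qed.

(** * The skew-symmetric argument of [Cay] in the retraction, and the distance bound *)

Definition cayley_generator (R : realType) (n p : nat) (U xi : 'M[R]_(n, p)) :
    'M[R]_n :=
  2^-1 *: (P_ U *m xi *m U^T - U *m xi^T *m P_ U).

(** As P is symmetric, the generator is the skew part of P xi U^T. *)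
Lemma cayley_generatorE (R : realType) (n p : nat) (U xi : 'M[R]_(n, p)) :
  cayley_generator U xi =
    2^-1 *: (P_ U *m xi *m U^T - (P_ U *m xi *m U^T)^T).
Proof. by rewrite /cayley_generator !trmx_mul trmxK trmx_P mulmxA. Qed.

Lemma cayley_generator_skew (R : realType) (n p : nat) (U xi : 'M[R]_(n, p)) :
  (cayley_generator U xi)^T = - cayley_generator U xi.
Proof.
rewrite cayley_generatorE [LHS]linearZ /= -scalerN opprB; congr (_ *: _).
by rewrite [LHS]linearB /= trmxK.
Qed.

Lemma cayley_generator_line (R : realType) (n p : nat)
    (U xi delta : 'M[R]_(n, p)) (t : R) :
  cayley_generator U (xi + t *: delta) =
    cayley_generator U xi + t *: cayley_generator U delta.
Proof.
rewrite /cayley_generator scalerA [t * _]mulrC -scalerA -scalerDr; congr (_ *: _).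
(* [P_ U] is made opaque so that distributivity leaves it whole. *)
rewrite [(_ + _)^T]linearD /=; move: (P_ U) => P.
rewrite [(t *: _)^T]linearZ /= !(mulmxDr, mulmxDl).
by rewrite -!(scalemxAl, scalemxAr) scalerBr opprD addrACA.
Qed.

(** For X = P xi U^T, |X - X^T|^2 is at most 2 (|X|^2 + |X^T|^2) = 4 |X|^2, which the factor 1/2
    squared compensates; and |X| = |P xi| is at most |xi|. *)
Lemma cayley_generator_contraction (R : realType) (n p : nat)
    (U xi : 'M[R]_(n, p)) : stiefel U ->
  euclidean_metric (cayley_generator U xi) (cayley_generator U xi) <=
    euclidean_metric xi xi.
Proof.
move=> hU; rewrite cayley_generatorE euclidean_metricZ.
have := euclidean_metricB_le (P_ U *m xi *m U^T) (P_ U *m xi *m U^T)^T.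
rewrite euclidean_metric_trmx stiefel_isometry //.
have := P_contraction xi hU; lra.
Qed.

Theorem theorem3p13 (R : realType) (n p : nat) (hp : (0 < p)%N)
  (hpn : (p <= n)%N) (U xi eta : 'M[R]_(n, p)) (hU : stiefel U)
  (hxi : tangent U xi) (heta : tangent U eta)
  (hlt : frobenius_norm (xi - eta) < 1) :
  (distE (cayley_retraction U xi) (cayley_retraction U eta)
     <= (2 * asin (frobenius_norm (xi - eta)))%:E)%E.
Proof.
set A := cayley_generator U xi.
set B := cayley_generator U (eta - xi).
have At : A^T = - A by exact: cayley_generator_skew.
have Bt : B^T = - B by exact: cayley_generator_skew.
pose gamma t := Cay (A + t *: B) *m U.
have gammaP : stiefel_curve (cayley_retraction U xi)
    (cayley_retraction U eta) gamma.
  split.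
  (* A single piece is enough: I - A - t B is invertible for every real t, so [gamma] is smooth on
     the whole line. *)
  - exists [:: 1]; first by rewrite /itv_partition /= ltr01 eqxx.
    move=> i _; exists gamma => //; exact: smooth_cayley_curve.
  - by move=> t _; exact: cayley_curve_stiefel.
  - by rewrite /gamma scale0r addr0.
  - by rewrite /gamma -cayley_generator_line scale1r addrC subrK.
have d0 : 0 <= frobenius_norm (xi - eta) by exact: sqrtr_ge0.
apply: (@le_trans _ _ (curve_length 0 1 gamma)).
  by apply: ereal_inf_lbound; exists gamma.
apply: le_trans (cayley_curve_length At Bt hU) _.
rewrite lee_fin ler_pM2l //; apply: (@le_trans _ _ (frobenius_norm (xi - eta))).
  rewrite -[leRHS]ger0_norm // -sqrtr_sqr ler_wsqrtr // frobenius_norm_sqr.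
  rewrite (le_trans (cayley_generator_contraction _ hU)) //.
  (* [B] comes from eta - xi, the statement has xi - eta; the sign disappears in the square. *)
  by rewrite -opprB -scaleN1r euclidean_metricZ sqrrN expr1n mul1r.
by apply: asin_ge_id; rewrite d0.
Qed.
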